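(* Let $G$ be a finite group and let $r\geq 2$ be a prime with $\gcd(r,|G|)=1$. Then $P_r(G\wr S_{n+1})=P_r(G\wr S_n)$ for every $n\in\mathbb{N}$ with $n\not\equiv -1 \pmod r$. Equivalently, $|\omega_r(G\wr S_{n+1})|=|G|(n+1)\,|\omega_r(G\wr S_n)|$ for every such $n$.
   Context: For a finite group $G$, the wreath product $G\wr S_n$ is the set of pairs $(f,\pi)$ with $f:\{1,\dots,n\}\to G$ any function and $\pi\in S_n$, with multiplication $(f,\pi)(f',\pi')=(f f'_{\pi},\pi\pi')$, where $f'_\pi(i)=f'(\pi^{-1}(i))$ and functions are multiplied pointwise; it has order $|G|^n n!$. The power map $\omega_r:G\wr S_n\to G\wr S_n$ is $x\mapsto x^r$, $\omega_r(G\wr S_n)$ denotes its image (the set of $r$-th powers), and $P_r(G\wr S_n)=\frac{|\omega_r(G\wr S_n)|}{|G|^n n!}$. *)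

(* Defs.v *)
From mathcomp Require Import all_boot all_order all_algebra all_fingroup.
Set Implicit Arguments. Unset Strict Implicit. Unset Printing Implicit Defensive.

Definition wreath (gT : finGroupType) (n : nat) : finType :=
  ({ffun 'I_n -> gT} * 'S_n)%type.

(* (f,pi)(f',pi') = (f * f'_pi, pi pi'), f'_pi(i) = f'(pi^-1 i), and
   pi pi' = pi o pi' (composition of functions), which in mathcomp's
   convention for {perm _} is (pi' * pi)%g. *)
Definition wmul (gT : finGroupType) (n : nat) (x y : wreath gT n) : wreath gT n :=
  ([ffun i => (x.1 i * y.1 ((x.2)^-1%g i))%g], (y.2 * x.2)%g).

Definition wone (gT : finGroupType) (n : nat) : wreath gT n :=
  ([ffun => 1%g], 1%g).

Definition wpow (gT : finGroupType) (n : nat) (x : wreath gT n) (k : nat) : wreath gT n :=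
  iter k (wmul x) (wone gT n).

Definition omega (gT : finGroupType) (n r : nat) : {set wreath gT n} :=
  [set wpow x r | x : wreath gT n].

Definition Pr (gT : finGroupType) (n r : nat) : rat :=
  (#|omega gT n r|%:R / ((#|gT| ^ n * n`!)%:R))%R.

(* Main.v *)
(* Call a point singular for [x = (f, pi)] when the length of its [pi]-cycle is
   divisible by [r]. Every root of [x] commutes with [x], hence preserves the
   set [S] of singular points, while the part of [x] outside [S] has order prime
   to [r] and so is an r-th power of one of its own powers. Thus [x] is an r-th
   power iff its restriction to [S] is one, and the r-th powers with a given
   singular part are parametrised by the regular elements supported on the
   complement [B] of [S]. As [r] divides [#|S|] but not [n.+1], it does not
   divide [#|B|]; in that case the number [a m] of permutations of [m = #|B|]
   points without singular points satisfies [a m = m * a m.-1]. Hence double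
   counting pairs (r-th power, point at which it is trivial) gives the result,
   because the r-th powers trivial at a given point are the r-th powers of a
   copy of the wreath product on [n] points. *)

Require Import Defs.
From HB Require Import structures.
From mathcomp Require Import all_boot all_order all_algebra all_fingroup.
From mathcomp Require Import cyclic zify.

Set Implicit Arguments. Unset Strict Implicit. Unset Printing Implicit Defensive.
Local Open Scope nat_scope.

(** * Permutations without cycles of length divisible by r *)

Section RegularPermCount.

Variable r : nat.

(* The count of the permutations in [marked_perms] below, by the image of the
   marked point: it is fixed, or can be contracted out of its cycle. *)
Fixpoint marked_count (m l : nat) : nat :=
  if m is m'.+1 then
    m' * marked_count m' l.+1
    + ~~ (r %| l.+1) * (if m' is 0 then 1 else marked_count m' 0)
  else 0.

Definition regular_count (m : nat) : nat :=
  if m is 0 then 1 else marked_count m 0.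

Hypothesis r_gt1 : 1 < r.

(** For [l = 0] this says that [regular_count m.+1] is [m] times [regular_count m] if [r] divides
    [m.+1], and [m.+1] times it otherwise. General [l] is needed because the recursion raises [l];
    the correction stands on the left to avoid truncated subtraction. *)
Lemma marked_countE m l :
  marked_count m.+1 l + ((m.+1 + l) %% r < m %% r) * regular_count m
  = (m + ~~ (r %| l.+1)) * regular_count m.
Proof.
elim: m l => [|m IH] l; first by rewrite /= mod0n ltn0 mul0n !muln1 addn0.
have dvdx k : (r %| k.+2) = ((m.+2 + k) %% r == m %% r).
  have -> : m.+2 + k = m + k.+2 by rewrite addnC !addnS addnC.
  by rewrite -[X in _ == X %[mod r]]addn0 eqn_modDl mod0n.
have modS : m.+1 %% r = if (m %% r).+1 == r then 0 else (m %% r).+1.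
  rewrite -addn1 -modnDml addn1; case: eqP => [->|/eqP ne]; first by rewrite modnn.
  by rewrite modn_small // ltn_neqAle ne ltn_mod ltnW.
have sr : m %% r < r by rewrite ltn_mod ltnW.
have xr : (m.+2 + l) %% r < r by rewrite ltn_mod ltnW.
(* These two instances express [regular_count m.+1] and [marked_count m.+1 l.+1] as multiples of
   [regular_count m], with factors depending only on [m] and on the residues [x] and [s]; the rest
   is a case analysis on these residues. *)
have := IH 0; rewrite addn0 dvdn1.
have := IH l.+1; rewrite dvdx addnS -addSn modS.
have -> : marked_count m.+2 l = m.+1 * marked_count m.+1 l.+1
   + ~~ (r %| l.+1) * regular_count m.+1 by [].
have -> : marked_count m.+1 0 = regular_count m.+1 by [].
have -> : (r == 1) = false by apply/negbTE; rewrite neq_ltn r_gt1 orbT.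
set x := _ %% r in xr *; set s := m %% r in sr *; set u := regular_count m.
set v := regular_count m.+1; set w := marked_count _ _; set b := ~~ (_ %| _).
case: (s.+1 =P r) => [sE|/eqP sE].
  have -> : (0 < s) = true by lia.
  case: ltngtP => [?|?|?] /=; [|lia|]; case: b => /=; nia.
have -> : (s.+1 < s) = false by lia.
rewrite (ltnS x s).
case: ltngtP => [?|?|?] /=; case: b => /=; nia.
Qed.

Lemma regular_countS m :
  ~~ (r %| m.+1) -> regular_count m.+1 = m.+1 * regular_count m.
Proof.
move=> ndv; have := marked_countE m 0; rewrite addn0 dvdn1.
have -> : (r == 1) = false by apply/negbTE; rewrite neq_ltn r_gt1 orbT.
(* The residue drops from [m] to [m.+1] only when [r] divides [m.+1]. *)
suff -> : (m.+1 %% r < m %% r) = false by rewrite mul0n addn0 addn1.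
have sr : m %% r < r by rewrite ltn_mod ltnW.
move: ndv; rewrite /dvdn -addn1 -modnDml addn1.
have [->|ne] := eqVneq (m %% r).+1 r; first by rewrite modnn.
rewrite modn_small ?ltn_neqAle ?ne //; lia.
Qed.

End RegularPermCount.

(** * Counting regular permutations by contracting a marked point *)

Section Orbits.
Variable T : finType.
Implicit Types (s t : {perm T}) (i j k : T) (B : {set T}).

Lemma eq_in_porbit s t i :
  {in porbit s i, t =1 s} -> porbit t i = porbit s i.
Proof.
move=> st; have E n : (t ^+ n)%g i = (s ^+ n)%g i.
  by elim: n => [|n IH]; rewrite ?expg0 // !expgSr !permM IH st ?mem_porbit.
by apply/setP=> x; apply/porbitP/porbitP=> -[n ->]; exists n; rewrite E.
Qed.

Lemma porbit_step s i x : (s x \in porbit s i) = (x \in porbit s i).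
Proof.
by rewrite -!eq_porbit_mem; have := porbit_perm s 1 x; rewrite expg1 => ->.
Qed.

Lemma porbit_fix s i : s i = i -> porbit s i = [set i].
Proof.
move=> si; apply/setP=> x; rewrite inE; apply/porbitP/eqP=> [[n ->]|->]; last first.
  by exists 0; rewrite expg0 perm1.
by elim: n => [|n IH]; rewrite ?expg0 ?perm1 // expgSr permM IH.
Qed.

(* [s * tperm i (s i)] shortcuts [i] out of its cycle. *)
Lemma porbit_contract s i :
  s i != i -> porbit (s * tperm i (s i)) (s i) = porbit s i :\ i.
Proof.
set j := s i; set t := (s * tperm i j)%g => ji.
have tE x : x != i -> t x = if s x == i then j else s x.
  move=> xi; rewrite permM; case: tpermP => [->|/perm_inj/eqP|]; rewrite ?eqxx //.
    by rewrite (negbTE xi).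
  by move/eqP/negbTE->.
have jO : j \in porbit s i by rewrite porbit_step porbit_id.
apply/setP=> x; apply/idP/idP.
  case/porbitP=> n ->{x}; elim: n => [|n]; first by rewrite expg0 perm1 !inE ji.
  rewrite expgSr permM; move: ((t ^+ n)%g j) => x; rewrite !inE => /andP[xi xO].
  by rewrite tE //; case: (eqVneq (s x) i) => sx; rewrite ?ji ?jO ?sx ?porbit_step.
rewrite !inE => /andP[xi] /porbitP[n xE]; rewrite {}xE in xi *.
(* The alternative lets the induction pass through [i], which the contracted cycle skips. *)
suff: ((s ^+ n)%g i == i) || ((s ^+ n)%g i \in porbit t j) by rewrite (negbTE xi).
elim: n {xi} => [|n]; first by rewrite expg0 perm1 eqxx.
rewrite expgSr permM; move: ((s ^+ n)%g i) => y.
have [->|yi] /= := eqVneq y i; first by rewrite porbit_id orbT.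
by rewrite -(porbit_step t) tE //; case: eqP.
Qed.

Lemma porbit_contract_out s i k :
  k \notin porbit s i -> porbit (s * tperm i (s i)) k = porbit s k.
Proof.
move=> kO; apply: eq_in_porbit => x xk; rewrite permM.
have sxO : s x \notin porbit s i.
  apply: contra kO; rewrite porbit_step -!eq_porbit_mem in xk * => /eqP <-.
  by rewrite eq_sym.
by rewrite tpermD //; apply: contraNneq sxO => <-; rewrite ?porbit_step porbit_id.
Qed.

Variable r : nat.
Hypothesis r_gt1 : 1 < r.

Definition regular s := [forall i, ~~ (r %| #|porbit s i|)].

Definition regular_perms B := [set s | perm_on B s & regular s].

(* The orbit of the marked point [i] is treated as having [l] extra points. *)
Definition marked_perms B i l :=
  [set s | [&& perm_on B s, [forall k, (k \notin porbit s i) ==> ~~ (r %| #|porbit s k|)]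
             & ~~ (r %| #|porbit s i| + l)]].

Lemma ndvd1 : ~~ (r %| 1).
Proof. by rewrite dvdn1 neq_ltn r_gt1 orbT. Qed.

Lemma marked_perms0 B i : marked_perms B i 0 = regular_perms B.
Proof.
apply/setP=> s; rewrite !inE addn0; congr andb.
apply/andP/forallP=> [[/forallP out iO] k|reg]; last first.
  by split=> //; apply/forallP=> k; apply/implyP.
have [kO|/(implyP (out k))//] := boolP (k \in porbit s i).
by move: kO; rewrite -eq_porbit_mem => /eqP->.
Qed.

Lemma perm_onD1 B i s : i \in B -> (perm_on (B :\ i) s) = perm_on B s && (s i == i).
Proof.
move=> iB; apply/idP/andP=> [sB|[sB /eqP si]].
  split; last by rewrite (out_perm sB) // !inE eqxx.
  by apply: subset_trans sB (subD1set _ _).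
apply/subsetP=> x; rewrite !inE => sx; rewrite (subsetP sB) // andbT.
by apply: contraNneq sx => ->; rewrite si.
Qed.

(** The cycle of [i] has length 1, so the marked condition depends on [l] alone, and as [r] does not
    divide 1 the other cycles are those of a regular permutation of [B :\ i]. *)
Lemma marked_perms_fix B i l : i \in B ->
  #|[set s in marked_perms B i l | s i == i]|
  = ~~ (r %| l.+1) * #|regular_perms (B :\ i)|.
Proof.
move=> iB; case: (boolP (r %| l.+1)) => rl /=.
  rewrite mul0n; apply: eq_card0 => s; rewrite !inE; apply/negbTE.
  apply/negP=> /andP[/and3P[_ _ +] /eqP si].
  by rewrite porbit_fix // cards1 add1n rl.
rewrite mul1n; apply: eq_card => s; rewrite !inE perm_onD1 //.
case: (perm_on B s) => //=; rewrite [in RHS]andbC.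
apply: andb_id2r => /eqP si; rewrite porbit_fix // cards1 add1n rl andbT.
apply: eq_forallb => k; rewrite inE; case: eqVneq => //= ->.
by rewrite porbit_fix // cards1 ndvd1.
Qed.

(** Multiplication by [tperm i j] is the bijection: it contracts [i] out of its cycle and passes the
    mark to [j]. The cycle loses one point, which the extra point in [l.+1] makes up for. *)
Lemma marked_perms_move B i j l : i \in B -> j \in B :\ i ->
  #|[set s in marked_perms B i l | s i == j]| = #|marked_perms (B :\ i) j l.+1|.
Proof.
move=> iB; rewrite !inE => /andP[ji jB].
rewrite -[RHS](card_rcoset _ (tperm i j)); apply: eq_card => s.
rewrite mem_rcoset tpermV !inE perm_onD1 // permM.
have tB : perm_on B (tperm i j).
  by apply: subset_trans (tperm_on i j) _; apply/subsetP=> x /set2P[]->.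
have -> : perm_on B (s * tperm i j)%g = perm_on B s.
  apply/idP/idP=> sB; last exact: perm_onM.
  by rewrite -[s](mulgK (tperm i j)) tpermV perm_onM.
have -> : (tperm i j (s i) == i) = (s i == j).
  by rewrite -[X in _ == X](tpermR i j) (inj_eq perm_inj).
case: eqVneq => [sij|]; rewrite ?(andbF, andbT) //=; subst j.
case: (perm_on B s) => //=.
rewrite porbit_contract // addnS -addSn.
have -> : (#|porbit s i :\ i|.+1 = #|porbit s i|).
  by rewrite (cardsD1 i (porbit s i)) porbit_id.
congr andb; apply: eq_forallb => k; rewrite !inE negb_and negbK.
have [->|ki] /= := eqVneq k i; last first.
  by case kO: (k \in porbit s i) => //=; rewrite porbit_contract_out ?kO.
(* The point [i] has become an unmarked cycle of length 1, which is harmless. *)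
by rewrite porbit_id /= porbit_fix ?permM ?tpermR // cards1 ndvd1.
Qed.

(** The two counts depend on each other: marked permutations of [m.+1] points require regular ones
    of [m] points, which in turn are marked ones with [l = 0]. The marked count is therefore a
    hypothesis here, supplied by the induction that follows. *)
Lemma card_regular_perms_marked m :
    (forall B i l, #|B| = m -> i \in B -> #|marked_perms B i l| = marked_count r m l) ->
  forall B, #|B| = m -> #|regular_perms B| = regular_count r m.
Proof.
case: m => [_ B /cards0_eq-> |m markE B Bm].
  rewrite -[RHS](cards1 (1%g : {perm T})); apply: eq_card => s; rewrite !inE.
  apply/andP/eqP=> [[s0 _]|->]; first by apply: perm_on_id s0 _; rewrite cards0.
  rewrite perm_on1; split=> //; apply/forallP=> i.
  by rewrite porbit_fix ?perm1 // cards1 ndvd1.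
have /card_gt0P[i iB] : 0 < #|B| by rewrite Bm.
by rewrite -(marked_perms0 _ i) markE.
Qed.

Lemma card_marked_perms m B i l :
  #|B| = m -> i \in B -> #|marked_perms B i l| = marked_count r m l.
Proof.
elim: m B i l => [|m IH] B i l Bm iB; first by rewrite (cards0_eq Bm) inE in iB.
have Bi : #|B :\ i| = m by move: Bm; rewrite (cardsD1 i) iB => -[].
rewrite -sum1_card (partition_big (fun s : {perm T} => s i) (mem B)) /=; last first.
  by move=> s; rewrite inE => /and3P[sB _ _]; rewrite perm_closed.
rewrite (bigD1 i) //= sum1dep_card marked_perms_fix // addnC; congr (_ + _ * _).
  transitivity (\sum_(j in B :\ i) marked_count r m l.+1).
    apply: eq_big => [j|j /andP[jB ji]]; first by rewrite !inE andbC.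
    by rewrite sum1dep_card marked_perms_move ?IH // !inE ji.
  by rewrite sum_nat_const Bi.
by rewrite (card_regular_perms_marked IH Bi); case: (m).
Qed.

Lemma card_regular_perms B : #|regular_perms B| = regular_count r #|B|.
Proof. exact: card_regular_perms_marked (@card_marked_perms _) _ _. Qed.

End Orbits.

Local Open Scope group_scope.

(** * Stable sets, commuting permutations and singular points *)

Section PermExtra.
Variables (T : finType).
Implicit Types (s t : {perm T}) (S : {set T}) (i k : T).

Lemma stabP s S : reflect (forall i, (s i \in S) = (i \in S)) (s \in 'N(S | 'P)).
Proof.
apply: (iffP idP) => [sN i|sS]; first by rewrite -[s i]/(aperm i s) (astabs_act _ sN).
by rewrite inE; apply/andP; split; rewrite inE //; apply/subsetP=> i iS; rewrite inE /= /aperm sS.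
Qed.

Lemma stabC s S : (s \in 'N(~: S | 'P)) = (s \in 'N(S | 'P)).
Proof.
by apply/stabP/stabP=> sS i; have := sS i; rewrite !inE; [move/negb_inj | move->].
Qed.

Lemma perm_on_stab s S : perm_on S s -> s \in 'N(S | 'P).
Proof. by move=> sS; apply/stabP=> i; rewrite perm_closed. Qed.

Lemma restr_perm_fun s S i :
  s \in 'N(S | 'P) -> restr_perm S s i = if i \in S then s i else i.
Proof.
move=> sN; case: ifP => iS; first exact: restr_permE.
by rewrite (out_perm (restr_perm_on _ _)) ?iS.
Qed.

Lemma porbit_restr_perm s S i : s \in 'N(S | 'P) ->
  porbit (restr_perm S s) i = if i \in S then porbit s i else [set i].
Proof.
move=> sN; case: ifP => iS; last by rewrite porbit_fix ?restr_perm_fun ?iS.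
apply: eq_in_porbit => k /porbitP[n ->]; rewrite restr_perm_fun //.
suff -> : (s ^+ n)%g i \in S by [].
by rewrite -[_ i]/(aperm i _) (astabs_act _ (groupX n sN)).
Qed.

Lemma card_porbit_commute s t i : commute s t -> #|porbit s (t i)| = #|porbit s i|.
Proof.
move=> st; rewrite -(card_imset (porbit s i) (@perm_inj _ t)); apply: eq_card => x.
apply/porbitP/imsetP=> [[n ->]|[_ /porbitP[n ->] ->]].
  by exists ((s ^+ n)%g i); rewrite ?mem_porbit // -!permM (commuteX n (commute_sym st)).
by exists n; rewrite -!permM (commuteX n (commute_sym st)).
Qed.

(** The set is a disjoint union of cycles whose lengths are all divisible by [r]. *)
Lemma dvdn_card_singular r s : r %| #|[set i | r %| #|porbit s i|]|.
Proof.
rewrite -sum1_card (partition_big (porbit s) predT) //=; apply: dvdn_sum => O _.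
rewrite sum1dep_card.
have [->|[i]] := set_0Vmem [set i in [set i | r %| #|porbit s i|] | porbit s i == O].
  by rewrite cards0.
rewrite !inE => /andP[ri /eqP iO]; rewrite -iO.
suff -> : [set k in [set k | r %| #|porbit s k|] | porbit s k == porbit s i] = porbit s i by [].
apply/setP=> k; rewrite !inE -eq_porbit_mem; case: eqP => [->|]; rewrite ?andbF ?ri //.
Qed.

Lemma perm_expg_porbit s i m : #|porbit s i| %| m -> (s ^+ m)%g i = i.
Proof.
case/dvdnP=> q ->; rewrite mulnC expgM.
have E : (s ^+ #|porbit s i|)%g i = i by rewrite permX iter_porbit.
by elim: q => [|q IH]; rewrite ?expg0 ?perm1 // expgSr permM IH.
Qed.

End PermExtra.

(** * The wreath product as a group *)

Section WreathGroup.
Variables (gT : finGroupType) (n : nat).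

(* An alias, since [wreath gT n] is convertible to a product type, on which
   mathcomp already has the direct product group structure. *)
Definition wr : Type := wreath gT n.
HB.instance Definition _ := Finite.copy wr (wreath gT n).

Definition wmk (f : 'I_n -> gT) (s : 'S_n) : wr := ([ffun i => f i], s).
Definition base (x : wr) (i : 'I_n) : gT := x.1 i.
Definition top (x : wr) : 'S_n := x.2.
Definition winv (x : wr) : wr := wmk (fun i => (base x (top x i))^-1)%g (top x)^-1%g.

Lemma wrP (x y : wr) : top x = top y -> base x =1 base y -> x = y.
Proof.
by case: x y => [f s] [g t] /= -> fg; congr pair; apply/ffunP => i; apply: fg.
Qed.

Lemma base_mk f s i : base (wmk f s) i = f i. Proof. by rewrite /base ffunE. Qed.

Lemma wmulA : associative (@wmul gT n : wr -> wr -> wr).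
Proof.
move=> x y z; apply: wrP => [|i]; first by rewrite /= mulgA.
by rewrite /base /= !ffunE mulgA invMg permM.
Qed.

Lemma wmul1 : left_id (wone gT n : wr) (@wmul gT n).
Proof.
move=> x; apply: wrP => [|i]; first by rewrite /top /= mulg1.
by rewrite /base /= !ffunE mul1g invg1 perm1.
Qed.

Lemma wmulV : left_inverse (wone gT n : wr) winv (@wmul gT n).
Proof.
move=> x; apply: wrP => [|i]; first by rewrite /top /= mulgV.
by rewrite /base /= !ffunE invgK mulVg.
Qed.

HB.instance Definition _ := Finite_isGroup.Build wr wmulA wmul1 wmulV.

Implicit Types (x y z u v : wr) (S B D : {set 'I_n}).

Lemma topM x y : top (x * y)%g = (top y * top x)%g. Proof. by []. Qed.
Lemma baseM x y i : base (x * y)%g i = (base x i * base y ((top x)^-1 i))%g.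
Proof. by rewrite /base ffunE. Qed.
Lemma base1 i : base 1%g i = 1%g. Proof. by rewrite /base ffunE. Qed.
Lemma topV x : top x^-1%g = (top x)^-1%g. Proof. by []. Qed.
Lemma baseV x i : base x^-1%g i = (base x (top x i))^-1%g.
Proof. exact: base_mk. Qed.
Lemma topX x m : top (x ^+ m)%g = (top x ^+ m)%g.
Proof. by elim: m => [|m IH]; rewrite ?expg0 // expgS topM IH expgSr. Qed.

Lemma wpowE (x : wr) m : wpow x m = (x ^+ m)%g :> wr.
Proof. by elim: m => [|m IH]; rewrite ?expg0 // expgS -IH. Qed.

(** The copy of the wreath product of [gT] with the symmetric group on [D]. *)
Definition supported D :=
  [set x | perm_on D (top x) & [forall i, (i \notin D) ==> (base x i == 1)]]%g.

Lemma supportedP D x :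
  reflect (perm_on D (top x) /\ forall i, i \notin D -> base x i = 1%g)
          (x \in supported D).
Proof.
rewrite inE; apply: (iffP andP) => -[xD bx]; split=> //.
  by move=> i iD; move/forallP/(_ i): bx; rewrite iD => /eqP.
by apply/forallP=> i; apply/implyP=> iD; rewrite bx.
Qed.

Lemma supported_group_set D : group_set (supported D).
Proof.
apply/group_setP; split=> [|x y /supportedP[xD bx] /supportedP[yD by_]].
  by apply/supportedP; split=> [|i _]; rewrite ?base1 // perm_on1.
apply/supportedP; split=> [|i iD]; first by rewrite topM perm_onM.
by rewrite baseM bx // mul1g (out_perm (perm_onV xD)) ?by_.
Qed.
Canonical supported_group D := Group (supported_group_set D).

Lemma supportedS S D : S \subset D -> supported S \subset supported D.
Proof.
move=> sSD; apply/subsetP=> x /supportedP[xS bx]; apply/supportedP; split.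
  exact: subset_trans sSD.
by move=> i iD; rewrite bx //; apply: contra iD; apply: (subsetP sSD).
Qed.

Lemma supported_commute D x y :
  x \in supported D -> y \in supported (~: D) -> commute x y.
Proof.
case/supportedP=> xD bx /supportedP[yD by_]; apply: wrP => [|i].
  rewrite !topM; apply: (perm_onC yD xD).
  by rewrite -setI_eq0 setIC setICr.
rewrite !baseM; have [iD|iD] := boolP (i \in D).
  rewrite (out_perm (perm_onV yD)) ?inE ?negbK // (by_ i) ?inE ?negbK //.
  by rewrite by_ ?mulg1 ?mul1g // inE negbK (perm_closed _ (perm_onV xD)).
rewrite (out_perm (perm_onV xD)) // bx // mul1g bx ?mulg1 //.
by have := perm_closed i (perm_onV yD); rewrite !inE iD.
Qed.

(** Meaningful when [top x] stabilises [S], where it is multiplicative; otherwise [restr_perm]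
    defaults to the identity. *)
Definition restr S x : wr :=
  wmk (fun i => if i \in S then base x i else 1%g) (restr_perm S (top x)).

Lemma restr_supported S x : restr S x \in supported S.
Proof.
apply/supportedP; split=> [|i iS]; first exact: restr_perm_on.
by rewrite base_mk (negbTE iS).
Qed.

Lemma restrM S x y : top x \in 'N(S | 'P) -> top y \in 'N(S | 'P) ->
  restr S (x * y)%g = (restr S x * restr S y)%g.
Proof.
move=> xN yN; apply: wrP => [|i].
  exact: (morphM (restr_perm_morphism S)).
rewrite baseM !base_mk -(morphV (restr_perm_morphism S)) //=.
rewrite restr_perm_fun ?groupV //; case: ifP => iS; last by rewrite iS mulg1.
have /stabP-> : ((top x)^-1)%g \in 'N(S | 'P) by rewrite groupV.
by rewrite iS.
Qed.

Lemma restrX S x m : top x \in 'N(S | 'P) -> restr S (x ^+ m)%g = (restr S x ^+ m)%g.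
Proof.
move=> xN; elim: m => [|m IH].
  apply: wrP => [|i]; first by rewrite /top /= morph1.
  by rewrite base_mk !base1 if_same.
by rewrite !expgS restrM ?IH // topX groupX.
Qed.

Lemma restr_id S x : x \in supported S -> restr S x = x.
Proof.
case/supportedP=> xS bx; apply: wrP => [|i].
  apply/permP=> i; rewrite /= restr_perm_fun ?perm_on_stab //.
  by case: ifPn => // iS; rewrite (out_perm xS).
by rewrite base_mk; case: ifPn => // iS; rewrite bx.
Qed.

Lemma restr_triv S x : x \in supported (~: S) -> restr S x = 1%g.
Proof.
case/supportedP=> xS bx.
have xN : top x \in 'N(S | 'P) by rewrite -stabC perm_on_stab.
apply: wrP => [|i].
  apply/permP=> i; rewrite /= restr_perm_fun // perm1.
  by case: ifP => // iS; rewrite (out_perm xS) // inE negbK.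
by rewrite base_mk base1; case: ifP => // iS; rewrite bx // inE negbK.
Qed.

Lemma restr_mul S x : top x \in 'N(S | 'P) -> (restr S x * restr (~: S) x)%g = x.
Proof.
move=> xN; have xNC : top x \in 'N(~: S | 'P) by rewrite stabC.
apply: wrP => [|i].
  apply/permP=> i; rewrite topM permM /= !restr_perm_fun // !inE.
  by case iS: (i \in S) => //=; rewrite ?iS // (stabP _ _ xN) iS.
rewrite baseM !base_mk /= -(morphV (restr_perm_morphism S)) //= restr_perm_fun ?groupV // !inE.
have /stabP E : ((top x)^-1)%g \in 'N(S | 'P) by rewrite groupV.
by case iS: (i \in S) => /=; rewrite ?E iS /= ?mulg1 ?mul1g.
Qed.

End WreathGroup.

(** * r-th powers and their singular parts *)

Section PowersInWreath.
Variables (gT : finGroupType) (n r : nat).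
Implicit Types (x y z u v : wr gT n) (S B D : {set 'I_n}).
Hypothesis r_gt1 : (1 < r)%N.

Definition rpowers : {set wr gT n} := [set x ^+ r | x : wr gT n].

Definition sing x := [set i | r %| #|porbit (top x) i|].

Definition regular_elts B := [set u in supported gT B | regular r (top u)].

Lemma mem_regular_elts B u :
  (u \in regular_elts B) = (u \in supported gT B) && regular r (top u).
Proof. by rewrite inE. Qed.

Lemma sing_fix x i : top x i = i -> i \notin sing x.
Proof. by move=> xi; rewrite inE porbit_fix // cards1 ndvd1. Qed.

Lemma sing_sub_supp D x : x \in supported gT D -> sing x \subset D.
Proof.
case/supportedP=> xD _; apply/subsetP=> i; apply: contraLR => iD.
by rewrite sing_fix // (out_perm xD).
Qed.

(** A permutation commuting with [top x] maps each of its cycles onto one of the same length. *)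
Lemma sing_stab x y : commute x y -> top y \in 'N(sing x | 'P).
Proof.
move=> xy; apply/stabP=> i; rewrite !inE card_porbit_commute //.
by have := congr1 (@top gT n) xy; rewrite !topM => /commute_sym.
Qed.

Lemma restr_sing_regular x : restr (~: sing x) x \in regular_elts (~: sing x).
Proof.
have xN : top x \in 'N(~: sing x | 'P) by rewrite stabC sing_stab.
rewrite inE restr_supported; apply/forallP=> i; rewrite porbit_restr_perm //.
by case: ifP => iS; [rewrite !inE in iS; rewrite iS | rewrite cards1 ndvd1].
Qed.

Lemma sing_restr x : sing (restr (sing x) x) = sing x.
Proof.
have xN : top x \in 'N(sing x | 'P) by rewrite sing_stab.
apply/setP=> i; rewrite inE porbit_restr_perm //.
case: ifP => [|iS]; first by rewrite inE => ->.
by rewrite cards1 (negbTE (ndvd1 r_gt1)).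
Qed.

Hypothesis r_prime : prime r.
Hypothesis co_r : coprime r #|gT|.

(** Let [k] be the product over all points of the lengths of their cycles. Then [x ^+ k] lies in the
    base group, where powers are pointwise, so the order of [x] divides [k * #|gT|], which is
    coprime to [r]. *)
Lemma regular_order x : regular r (top x) -> coprime #[x] r.
Proof.
move/forallP=> reg; set k := (\prod_i #|porbit (top x) i|)%N.
have co_k : coprime r k.
  rewrite /k; elim/big_rec: _ => [|i m _ IH]; first exact: coprimen1.
  by rewrite coprimeMr IH prime_coprime ?reg.
have topk : top (x ^+ k) = 1.
  apply/permP=> i; rewrite topX perm1 perm_expg_porbit //.
  by rewrite /k (bigD1 i) //= dvdn_mulr.
have basek m i : base (x ^+ k ^+ m) i = base (x ^+ k) i ^+ m.
  elim: m => [|m IH]; first by rewrite !expg0 base1.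
  by rewrite !expgS baseM topk invg1 perm1 IH.
suff xkG : x ^+ (k * #|gT|) = 1.
  rewrite coprime_sym; apply: coprime_dvdr (_ : #[x] %| k * #|gT|)%N _.
    by rewrite order_dvdn xkG.
  by rewrite coprimeMr co_k.
rewrite expgM; apply: wrP => [|i]; first by rewrite topX topk expg1n.
by rewrite basek base1 -cardsT expg_cardG ?inE.
Qed.

(** The exponent [r] is invertible modulo the order of [u]. Being a power of [u], the root lies in
    every subgroup that contains [u], which controls its support. *)
Lemma regular_root u : regular r (top u) -> exists2 v, v \in <[u]> & v ^+ r = u.
Proof.
move/regular_order => co_u; exists (u ^+ expg_invn <[u]> r); first exact: mem_cycle.
by rewrite expgAC (expgK co_u) ?cycle_id.
Qed.

Lemma rpower_restr x : x \in rpowers ->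
  exists2 y, y \in supported gT (sing x) & y ^+ r = restr (sing x) x.
Proof.
case/imsetP=> y _ xE; exists (restr (sing x) y); first exact: restr_supported.
rewrite -restrX -?xE // sing_stab //.
by rewrite xE; apply: commute_sym; apply: commuteX.
Qed.

(** A given root of [x] may act outside [D]. A new one is assembled from its restriction to the
    singular points, which lie in [D], and a root of the regular part among the powers of that part;
    the disjoint supports make the two factors commute. *)
Lemma supported_root D x : x \in rpowers -> x \in supported gT D ->
  exists2 y, y \in supported gT D & y ^+ r = x.
Proof.
move=> xP xD; have [y yS yr] := rpower_restr xP.
have := restr_sing_regular x; rewrite inE => /andP[uS reg].
have [v vu vr] := regular_root reg.
have sSD := subsetP (supportedS gT (sing_sub_supp xD)).
have xE : restr (sing x) x * restr (~: sing x) x = x by rewrite restr_mul ?sing_stab.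
have uD : restr (~: sing x) x \in supported gT D.
  by rewrite -(groupMl _ (sSD _ (restr_supported _ x))) xE.
have sub_u A : restr (~: sing x) x \in supported gT A -> v \in supported gT A.
  by move=> uA; apply: (subsetP _ v vu); rewrite cycle_subG.
exists (y * v); first by apply: groupM; [apply: sSD | apply: sub_u].
by rewrite expgMn ?yr ?vr //; apply: supported_commute yS (sub_u _ uS).
Qed.

(* The possible restrictions of r-th powers to the union of their singular cycles. *)
Definition singular_rpowers := [set z in rpowers | z \in supported gT (sing z)].

(** Multiplying [z] by a regular [u] on the complement creates no singular point and leaves the
    singular part [z]; roots of [z] and [u] with disjoint supports multiply to a root of [z * u]. *)
Lemma rpowers_fiber z : z \in singular_rpowers ->
  [set x in rpowers | restr (sing x) x == z] = z *: regular_elts (~: sing z).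
Proof.
rewrite inE => /andP[zP zS]; apply/setP=> x; rewrite mem_lcoset.
have zN : top z \in 'N(sing z | 'P) by rewrite sing_stab.
rewrite inE; apply/andP/idP=> [[xP /eqP xz]|].
  have zx : sing z = sing x by rewrite -xz sing_restr.
  have := restr_mul (sing_stab (commute_refl x)); rewrite xz => <-.
  by rewrite mulKg zx restr_sing_regular.
have -> : x = z * (z^-1 * x) by rewrite mulKVg.
move: (z^-1 * x) => u; rewrite mulKg inE => /andP[uS ureg].
have uN : top u \in 'N(sing z | 'P).
  by rewrite -stabC perm_on_stab //; case/supportedP: uS.
have ruz : restr (sing z) (z * u) = z.
  by rewrite restrM // (restr_id zS) (restr_triv uS) mulg1.
have ruu : restr (~: sing z) (z * u) = u.
  by rewrite restrM ?stabC // (restr_id uS) restr_triv ?setCK // mul1g.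
have zuN : top (z * u) \in 'N(sing z | 'P) by rewrite topM groupM.
have singE : sing (z * u) = sing z.
  apply/setP=> i; rewrite inE; case: (boolP (i \in sing z)) => iS.
    have := porbit_restr_perm i zuN; rewrite iS => <-.
    by rewrite -[restr_perm _ _]/(top (restr (sing z) (z * u))) ruz; rewrite inE in iS.
  have zuNC : top (z * u) \in 'N(~: sing z | 'P) by rewrite stabC.
  have := porbit_restr_perm i zuNC; rewrite inE iS /= => <-.
  rewrite -[restr_perm _ _]/(top (restr (~: sing z) (z * u))) ruu.
  exact/negbTE/(forallP ureg).
rewrite singE ruz; split=> //.
have [y yS yr] := supported_root zP zS; have [v vu vr] := regular_root ureg.
apply/imsetP; exists (y * v) => //; rewrite expgMn ?yr ?vr //.
by apply: supported_commute yS (subsetP _ v vu); rewrite cycle_subG.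
Qed.

Lemma restr_singular_rpowers x : x \in rpowers -> restr (sing x) x \in singular_rpowers.
Proof.
move=> xP; rewrite inE sing_restr restr_supported andbT.
by have [y _ <-] := rpower_restr xP; apply/imsetP; exists y.
Qed.

Lemma card_rpowers :
  #|rpowers| = (\sum_(z in singular_rpowers) #|regular_elts (~: sing z)|)%N.
Proof.
rewrite -sum1_card (partition_big (fun x => restr (sing x) x) (mem singular_rpowers)).
  apply: eq_bigr => z zS; rewrite -(card_lcoset _ z) -rpowers_fiber //.
  by rewrite sum1dep_card.
exact: restr_singular_rpowers.
Qed.

(** * Counting the r-th powers that are trivial at a given point *)

Lemma supportedD1 B i : i \in B ->
  supported gT (B :\ i) = supported gT B :&: supported gT [set~ i].
Proof.
move=> iB; apply/setP=> x; apply/idP/setIP=> [xB|].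
  split; apply: (subsetP (supportedS gT _)) xB; first exact: subsetDl.
  by apply/subsetP=> k; rewrite !inE => /andP[].
case=> /supportedP[xB bx] /supportedP[xi by_]; apply/supportedP; split.
  rewrite perm_onD1 // xB (out_perm xi) ?eqxx // !inE eqxx //.
move=> k; rewrite !inE negb_and negbK => /orP[/eqP->|]; last exact: bx.
by rewrite by_ // !inE eqxx.
Qed.

Lemma supportedC1P i x :
  reflect (top x i = i /\ base x i = 1) (x \in supported gT [set~ i]).
Proof.
apply: (iffP (supportedP _ _)) => -[xi bx].
  by rewrite (out_perm xi) ?bx // !inE eqxx.
split=> [|k]; last by rewrite !inE negbK => /eqP->.
by apply/subsetP=> k; rewrite !inE; apply: contraNneq => ->; rewrite xi.
Qed.

(** Since [z] is itself trivial at [i], the product [z * u] is trivial at [i] exactly when [u]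
    is. *)
Lemma rpowers_fiber_fixing z i : z \in singular_rpowers -> i \in ~: sing z ->
  [set x in rpowers | restr (sing x) x == z] :&: supported gT [set~ i]
  = z *: regular_elts (~: sing z :\ i).
Proof.
move=> zS iz; rewrite rpowers_fiber //; apply/setP=> x.
have zi : z^-1 \in supported gT [set~ i].
  move: zS iz; rewrite groupV inE in_setC => /andP[_ zS] iz.
  apply: (subsetP (supportedS gT _)) zS.
  by apply/subsetP=> k; rewrite in_setC1; apply: contraTneq => ->.
rewrite in_setI !mem_lcoset -(groupMl x zi) !mem_regular_elts.
by rewrite supportedD1 // in_setI andbAC.
Qed.

Lemma card_rpowers_fixing i :
  #|rpowers :&: supported gT [set~ i]|
  = (\sum_(z in singular_rpowers | i \in ~: sing z) #|regular_elts (~: sing z :\ i)|)%N.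
Proof.
rewrite -sum1_card (partition_big (fun x => restr (sing x) x)
  (fun z => (z \in singular_rpowers) && (i \in ~: sing z))) /=; last first.
  (* An element trivial at [i] fixes [i], so only the [z] for which [i] is not singular occur. *)
  move=> x; rewrite inE => /andP[xP /supportedC1P[xi _]].
  by rewrite restr_singular_rpowers // sing_restr inE sing_fix.
apply: eq_bigr => z /andP[zS iz]; rewrite -(card_lcoset _ z) -rpowers_fiber_fixing //.
rewrite -sum1_card; apply: eq_bigl => x.
by rewrite !inE andbAC.
Qed.

Lemma card_supported_cond D (P : pred 'S_n) :
  #|[set x in supported gT D | P (top x)]|
  = (#|gT| ^ #|D| * #|[set s | perm_on D s && P s]|)%N.
Proof.
(* The base parts are the functions with default value 1 off [D]. *)
rewrite -[#|gT|]cardsT -(card_pffun_on (1 : gT) (mem D) (mem [set: gT])).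
rewrite -[#|pffun_on _ _ _|]cardsE -cardsX; apply: eq_card => -[f s].
rewrite !inE /=.
rewrite [in RHS]andbCA -andbA; congr (_ && (_ && _)); apply: eq_forallb => i.
by case: (i \in D); rewrite !inE.
Qed.

Lemma card_supported D : #|supported gT D| = (#|gT| ^ #|D| * #|D|`!)%N.
Proof.
have -> : supported gT D = [set x in supported gT D | predT (top x)].
  by apply/setP=> x; rewrite [in RHS]inE andbT.
rewrite card_supported_cond -card_perm; congr (_ * _)%N.
by apply: eq_card => s; rewrite !inE andbT.
Qed.

Lemma card_regular_elts B :
  #|regular_elts B| = (#|gT| ^ #|B| * regular_count r #|B|)%N.
Proof. by rewrite card_supported_cond (card_regular_perms r_gt1). Qed.

Lemma card_regular_elts_fixing B : ~~ (r %| #|B|) ->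
  #|regular_elts B| = (#|gT| * \sum_(i in B) #|regular_elts (B :\ i)|)%N.
Proof.
(* An empty [B] is excluded because [r] divides 0. *)
rewrite card_regular_elts; case Bm: #|B| => [|m]; first by rewrite dvdn0.
move=> ndv; rewrite (eq_bigr (fun=> #|gT| ^ m * regular_count r m)%N); last first.
  move=> i iB; rewrite card_regular_elts.
  by have := cardsD1 i B; rewrite iB Bm add1n => -[<-].
by rewrite sum_nat_const Bm regular_countS // expnS; lia.
Qed.

(* Double counting of the pairs of an r-th power and a point at which it is trivial. *)
Lemma card_rpowers_sum : ~~ (r %| n) ->
  #|rpowers| = (#|gT| * \sum_i #|rpowers :&: supported gT [set~ i]|)%N.
Proof.
move=> ndv; under [in RHS]eq_bigr do rewrite card_rpowers_fixing.
rewrite (exchange_big_dep (mem singular_rpowers)) /=; last by move=> i z _ /andP[].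
rewrite card_rpowers big_distrr; apply: eq_bigr => z zS.
rewrite card_regular_elts_fixing.
  by congr (_ * _)%N; apply: eq_bigl => i; rewrite zS.
apply: contra ndv => rB; rewrite -[n]card_ord -(cardsC (sing z)).
by rewrite dvdn_addr ?dvdn_card_singular.
Qed.

(** Conjugation by a transposition with trivial base part preserves r-th powers and exchanges the
    two points. *)
Lemma card_rpowers_fixingE i j :
  #|rpowers :&: supported gT [set~ i]| = #|rpowers :&: supported gT [set~ j]|.
Proof.
suff le k l : (#|rpowers :&: supported gT [set~ k]|
               <= #|rpowers :&: supported gT [set~ l]|)%N.
  by apply/eqP; rewrite eqn_leq !le.
set g : wr gT n := wmk (fun=> 1) (tperm k l).
rewrite -(cardJg _ g); apply: subset_leq_card; apply/subsetP=> _ /imsetP[x + ->].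
case/setIP=> /imsetP[y _ xE] /supportedC1P[xk bx]; apply/setIP; split.
  by apply/imsetP; exists (y ^ g); rewrite // xE conjXg.
have gl : top g l = k by rewrite /= tpermR.
apply/supportedC1P; rewrite conjgE !topM topV !permM gl xk.
split; first by rewrite -{1}gl permK.
by rewrite !baseM topV invgK gl bx baseV !base_mk invg1 !mul1g.
Qed.

End PowersInWreath.

(** * Passing from n to n + 1 *)

Section Embedding.
Variables (gT : finGroupType) (n r : nat).
Hypotheses (r_prime : prime r) (co_r : coprime r #|gT|).

Definition wlift (x : wr gT n) : wr gT n.+1 :=
  wmk (fun i => oapp (base x) 1 (unlift ord_max i)) (lift_perm ord_max ord_max (top x)).

Lemma wliftM : {morph wlift : x y / x * y}.
Proof.
move=> x y; apply: wrP => [|i]; first by rewrite !topM /= lift_permM.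
rewrite baseM !base_mk /= lift_permV.
case: (unliftP ord_max i) => [j ->|->] /=.
  by rewrite lift_perm_lift liftK baseM.
by rewrite lift_perm_id unlift_none /= mulg1.
Qed.

Lemma wlift_inj : injective wlift.
Proof.
move=> x y xy; apply: wrP => [|i].
  apply/permP=> i; have := congr1 (fun z => top z (lift ord_max i)) xy.
  by rewrite /= !lift_perm_lift => /lift_inj.
have := congr1 (fun z => base z (lift ord_max i)) xy.
by rewrite !base_mk liftK.
Qed.

Lemma wliftX x m : wlift (x ^+ m) = wlift x ^+ m.
Proof.
elim: m => [|m IH]; last by rewrite !expgS wliftM IH.
by apply: (mulgI (wlift 1)); rewrite -wliftM !mulg1.
Qed.

(** Inclusion and equality of cardinals suffice, so no preimage has to be built. *)
Lemma wlift_im : wlift @: [set: wr gT n] = supported gT [set~ ord_max].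
Proof.
apply/eqP; rewrite eqEcard card_imset ?cardsT; last exact: wlift_inj.
apply/andP; split.
  apply/subsetP=> _ /imsetP[x _ ->]; apply/supportedC1P.
  by rewrite base_mk unlift_none /= lift_perm_id.
rewrite card_supported cardsC1 card_ord /=.
by rewrite card_prod card_ffun card_ord card_Sn.
Qed.

(** An r-th power of the larger group that lies in the embedded copy has, by [supported_root], a
    root in the copy, so it is an r-th power there too. *)
Lemma card_rpowers_wlift :
  #|rpowers gT n r| = #|rpowers gT n.+1 r :&: supported gT [set~ ord_max]|.
Proof.
rewrite -(card_imset _ wlift_inj); apply: eq_card => x.
apply/imsetP/setIP=> [[_ /imsetP[y _ ->] ->]|[xP xK]].
  split; first by rewrite wliftX; apply/imsetP; exists (wlift y).
  by rewrite -wlift_im imset_f.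
have [y] := supported_root (prime_gt1 r_prime) r_prime co_r xP xK.
rewrite -wlift_im => /imsetP[z _ ->] <-; exists (z ^+ r); rewrite ?wliftX //.
by apply/imsetP; exists z.
Qed.

Lemma card_rpowersS : ~~ (r %| n.+1) ->
  #|rpowers gT n.+1 r| = (#|gT| * n.+1 * #|rpowers gT n r|)%N.
Proof.
move=> ndv; rewrite (card_rpowers_sum (prime_gt1 r_prime) r_prime co_r ndv) -mulnA.
congr (_ * _)%N; under eq_bigr do rewrite (card_rpowers_fixingE _ _ _ ord_max).
by rewrite sum_nat_const card_ord card_rpowers_wlift.
Qed.

End Embedding.

Lemma card_omega (gT : finGroupType) (n r : nat) : #|omega gT n r| = #|rpowers gT n r|.
Proof.
congr #|pred_of_set _|; apply: eq_imset => x; exact: wpowE.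
Qed.

Import GRing.Theory Num.Theory.

Theorem theorem5p6 (gT : finGroupType) (r : nat) :
  prime r -> coprime r #|gT| ->
  forall n : nat, ~~ (r %| n.+1) ->
    Pr gT n.+1 r = Pr gT n r.
Proof.
move=> r_prime co_r n ndv; rewrite /Pr !card_omega card_rpowersS //.
have nz : ((#|gT| * n.+1)%:R != 0 :> rat)%R.
  by rewrite pnatr_eq0 -lt0n muln_gt0 -cardsT cardG_gt0.
by rewrite expnS factS mulnACA !(natrM _ (_ * _.+1)) -mulf_div divff ?mul1r.
Qed.
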